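(* Let $k=5$, $\alpha\in(0,1)$, $\sigma\geqslant0$, $\tau>0$, and let $q_j^k$, $j\geqslant0$, be the real numbers defined in the context. Then for any positive integer $N$ and any $v^1,\dots,v^N\in H$, $$\sum_{n=1}^N\Big(\sum_{j=0}^{n-1}q_j^k\,v^{n-j},\,v^n\Big)\geqslant 0$$ (if the scalars are complex, the left-hand side is replaced by its real part).
   Context: $(H,(\cdot,\cdot))$ is a Hilbert space. With $k=5$, the real numbers $g_j^k$ are defined by the power series expansion at $\zeta=0$ $$\Big(\sum_{j=1}^{k}\frac1j\,(1-e^{-\sigma\tau}\zeta)^j\Big)^\alpha=\sum_{j=0}^\infty g_j^k\,\zeta^j,$$ where the branch of the power is the one that is positive at $\zeta=0$, and $$q_j^k=\sum_{m=0}^j\frac{m+1}{2^m}\,e^{-\sigma m\tau}\,g_{j-m}^k ,\qquad j\geqslant 0.$$ Equivalently, $\sum_{j\ge0}q_j^k\zeta^j$ is the power series at $\zeta=0$ of the function $\Big(\sum_{j=1}^{5}\frac1j\,(1-e^{-\sigma\tau}\zeta)^j\Big)^\alpha$ divided by $\left(1-\frac12e^{-\sigma\tau}\zeta\right)^2$. *)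

(* Defs.v *)
From HB Require Import structures.
From mathcomp Require Import all_boot all_order all_algebra sesquilinear.
From mathcomp Require Import all_classical all_reals all_analysis.
From mathcomp Require Import complex.

Set Implicit Arguments.
Unset Strict Implicit.
Unset Printing Implicit Defensive.

Import Order.TTheory GRing.Theory Num.Theory.
Import numFieldNormedType.Exports.

Local Open Scope classical_set_scope.
Local Open Scope ring_scope.

(* A Hilbert space over K is a complete normed module H over K together with
   an inner product inducing its norm.  For K = R the involution theta is the
   identity, for K = R[i] it is complex conjugation; the inner product is
   linear in its first argument. *)
Definition induces_norm (K : numFieldType) (theta : K -> K)
    (H : completeNormedModType K) (dot : {dot H for theta}) : Prop :=
  forall x : H, `|x| ^+ 2 = dot x x.

Section Coefficients.
Variable R : realType.
Implicit Types (alpha sigma tau zeta : R) (a f g : nat -> R).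

Definition bdf_symbol (k : nat) sigma tau zeta : R :=
  \sum_(1 <= j < k.+1) j%:R^-1 * (1 - expR (- (sigma * tau)) * zeta) ^+ j.

(* The sum of the power series is f on some neighbourhood of 0 (including
   convergence there); this determines the coefficients a uniquely. *)
Definition has_expansion_at0 (f : R -> R) a : Prop :=
  \forall zeta \near (0 : R), pseries a zeta @ \oo --> f zeta.

(* The variable zeta is real: the symbol is positive at 0, hence near 0, where
   powR is the positive real power, i.e. the restriction to the real axis of
   the branch that is positive at 0. *)
Definition is_g (k : nat) alpha sigma tau g : Prop :=
  has_expansion_at0 (fun zeta => bdf_symbol k sigma tau zeta `^ alpha) g.

Definition q_coef sigma tau g (j : nat) : R :=
  \sum_(0 <= m < j.+1)
    m.+1%:R / 2 ^+ m * expR (- (sigma * m%:R * tau)) * g (j - m)%N.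

End Coefficients.

(* Main.v *)
Require Import Defs.
From HB Require Import structures.
From mathcomp Require Import all_boot all_order all_algebra sesquilinear.
From mathcomp Require Import all_classical all_reals all_analysis.
From mathcomp Require Import complex.
From mathcomp Require Import lra ring.

Set Implicit Arguments.
Unset Strict Implicit.
Unset Printing Implicit Defensive.

Import Order.TTheory GRing.Theory Num.Theory.
Import numFieldNormedType.Exports.

Local Open Scope ring_scope.
Local Open Scope complex_scope.

(** Write z = rho X with rho = exp (- sigma tau), P(z) for the BDF symbol,
P = p0 (1 - w) with w(0) = 0, and D = (1 - z/2)^2. The form in the theorem is the
Toeplitz form of P^alpha / D, and it only depends on this series modulo X^N.

The binomial series (1 - w)^(alpha - 1) = sum_k m_k w^k has for coefficients the
moments of the Beta(1 - alpha, alpha) law on [0, 1], so formally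
P^alpha / D = p0^alpha * E_s [(1 - w) / (D (1 - s w))], and it suffices to treat each
s in [0, 1] separately. With Y = 1 / (D (1 - s w)) and U = (1 - w) Y, the form at s is
<U, D (1 - s w) Y> = s <U, D U> + (1 - s) <P Y, D Y> / p0.
Finally <U, D U> and <P Y, D Y> are nonnegative by explicit sums of squares that
only use the fact that multiplication by z is a contraction (Kalman-Yakubovich-Popov
certificates). *)

(** * Moments of the Beta law as limits of Polya urn moments *)

Section BetaMoments.
Variable R : archiRealFieldType.
Implicit Types a b c : R.

(** The coefficient of x^k in (1 - x)^(-c); for 0 < c < 1, the k-th moment of the Beta(c, 1 - c)
    law. *)
Definition risbin c k : R := \prod_(i < k) ((i%:R + c) / i.+1%:R).

Lemma risbin0 c : risbin c 0 = 1.
Proof. by rewrite /risbin big_ord0. Qed.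

Lemma risbinS c k : risbin c k.+1 = risbin c k * ((k%:R + c) / k.+1%:R).
Proof. by rewrite /risbin big_ord_recr. Qed.

Lemma risbinSm c k : k.+1%:R * risbin c k.+1 = (k%:R + c) * risbin c k.
Proof. by rewrite risbinS [LHS]mulrC -mulrA divfK ?pnatr_eq0// mulrC. Qed.

Lemma risbin_ge0 c k : 0 <= c -> 0 <= risbin c k.
Proof.
by move=> c0; apply: prodr_ge0 => i _; rewrite divr_ge0 ?addr_ge0.
Qed.

Lemma risbin1 k : risbin 1 k = 1.
Proof.
by apply: big1 => i _; rewrite -natr1 divff// natr1 pnatr_eq0.
Qed.

(** Vandermonde's identity, from (1 - x)^(-a) (1 - x)^(-b) = (1 - x)^(-a - b). The induction
    multiplies by n + 1 = j + (n + 1 - j), and [risbinSm] absorbs each part into its own factor. *)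
Lemma risbin_conv a b n :
  \sum_(j < n.+1) risbin a j * risbin b (n - j) = risbin (a + b) n.
Proof.
elim: n => [|n IHn]; first by rewrite big_ord1 !risbin0 mulr1.
apply: (@mulfI _ n.+1%:R); first by rewrite pnatr_eq0.
rewrite risbinSm -IHn !mulr_sumr.
under eq_bigr => j _.
  have -> : n.+1%:R * (risbin a j * risbin b (n.+1 - j)) =
    (j%:R * risbin a j) * risbin b (n.+1 - j)
    + risbin a j * ((n.+1 - j)%:R * risbin b (n.+1 - j)).
    by rewrite natrB ?(leq_ord j)//; ring.
  over.
rewrite big_split/= big_ord_recl !mul0r add0r [X in _ + X]big_ord_recr/=.
rewrite subnn !mul0r mulr0 addr0 -big_split/=; apply: eq_bigr => j _.
have jn : (j <= n)%N by rewrite -ltnS.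
rewrite /bump/= add1n subSS risbinSm subSn// risbinSm natrB//; ring.
Qed.

Lemma risbin_bin c j k : (k <= j)%N ->
  risbin c j * 'C(j, k)%:R = risbin c k * risbin (c + k%:R) (j - k).
Proof.
move=> /subnK <-; rewrite addnK; elim: (j - k)%N => [|i IHi].
  by rewrite add0n binn mulr1 risbin0 mulr1.
apply: (@mulfI _ i.+1%:R); first by rewrite pnatr_eq0.
rewrite [RHS]mulrCA risbinSm mulrCA -natrM.
have -> : (i.+1 * 'C(i.+1 + k, k) = (i + k).+1 * 'C(i + k, k))%N.
  by rewrite -{1}(addnK k i.+1) -mul_bin_down.
rewrite natrM mulrA [risbin c (i.+1 + k) * _]mulrC risbinSm -mulrA IHi natrD; ring.
Qed.

(* Expected value of [C(j,k) / C(n,k)] under the Polya urn law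
   [risbin a j * risbin b (n - j)]: it does not depend on [n]. *)
Lemma polya_moment a b n k : a + b = 1 -> (k <= n)%N ->
  \sum_(j < n.+1) risbin a j * risbin b (n - j) * 'C(j, k)%:R
  = risbin a k * 'C(n, k)%:R.
Proof.
move=> ab1 kn; have -> : 'C(n, k)%:R = risbin (1 + k%:R) (n - k).
  by have := risbin_bin 1 kn; rewrite !risbin1 !mul1r.
have -> : 1 + k%:R = (a + k%:R) + b by lra.
rewrite -risbin_conv -(big_mkord xpredT
  (fun j => risbin a j * risbin b (n - j) * 'C(j, k)%:R)).
rewrite (big_cat_nat _ (n := k))//=; last exact: leq_trans kn _.
rewrite big1_seq ?add0r; last first.
  by move=> j; rewrite mem_index_iota => /andP[_ jk]; rewrite bin_small ?mulr0.
rewrite -{1}(add0n k) big_addn subSn// big_mkord mulr_sumr; apply: eq_bigr => i _.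
rewrite mulrAC risbin_bin ?leq_addl// addnK -subnDA addnC; ring.
Qed.

(** Both quantities are the chance that k draws from n objects all hit j marked ones, with and
    without replacement. Draw number k + 1 changes the chance by at most k / n, and k^2 + k <= (k +
    1)^2. *)
Lemma ffact_pow_dist n j k : (j <= n)%N -> (k <= n)%N -> (0 < n)%N ->
  `|(j%:R / n%:R) ^+ k - 'C(j, k)%:R / 'C(n, k)%:R| <= (k * k)%:R / n%:R :> R.
Proof.
move=> jn kn n0.
elim: k kn => [|k IHk] kn.
  by rewrite !bin0 expr0 mul0n invr1 mulr1 subrr normr0 mul0r.
have n0' : 0 < n%:R :> R by rewrite ltr0n.
set x : R := j%:R / n%:R; pose u : R := 'C(j, k)%:R / 'C(n, k)%:R.
have x0 : 0 <= x by rewrite divr_ge0.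
have x1 : x <= 1 by rewrite ler_pdivrMr// mul1r ler_nat.
have Cnk : 0 < 'C(n, k)%:R :> R by rewrite ltr0n bin_gt0 ltnW.
have u0 : 0 <= u by rewrite divr_ge0.
have u1 : u <= 1 by rewrite ler_pdivrMr// mul1r ler_nat leq_bin2l.
have nk : 0 < (n - k)%:R :> R by rewrite ltr0n subn_gt0.
have -> : 'C(j, k.+1)%:R / 'C(n, k.+1)%:R = u * ((j - k)%:R / (n - k)%:R).
  rewrite /u mulf_div -!natrM !(mulnC _ (_ - _)%N) -!mul_bin_left !natrM -mulf_div.
  by rewrite divff ?mul1r// pnatr_eq0.
have step : `|u * (x - (j - k)%:R / (n - k)%:R)| <= k%:R / n%:R.
  (* For j < k the subtraction j - k truncates to 0, but then u = 0. *)
  have [jk|kj] := ltnP j k.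
    by rewrite /u bin_small// !mul0r normr0 divr_ge0.
  have -> : x - (j - k)%:R / (n - k)%:R = k%:R / n%:R * ((n - j)%:R / (n - k)%:R).
    rewrite /x !natrB ?(ltnW kn)//; field.
    by rewrite subr_eq0 eqr_nat !gt_eqF// ?ltr_nat.
  have v0 : 0 <= (n - j)%:R / (n - k)%:R :> R by rewrite divr_ge0.
  have v1 : (n - j)%:R / (n - k)%:R <= 1 :> R.
    by rewrite ler_pdivrMr// mul1r ler_nat leq_sub2l.
  have w0 : 0 <= k%:R / n%:R :> R by rewrite divr_ge0.
  by rewrite ger0_norm ?(mulr_ge0 u0 (mulr_ge0 w0 v0))// mulrCA ler_piMr// mulr_ile1.
rewrite exprSr.
have -> : x ^+ k * x - u * ((j - k)%:R / (n - k)%:R) =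
  (x ^+ k - u) * x + u * (x - (j - k)%:R / (n - k)%:R) by ring.
apply: (le_trans (ler_normD _ _)); rewrite normrM (ger0_norm x0).
apply: (@le_trans _ _ ((k * k)%:R / n%:R + k%:R / n%:R)).
  apply: lerD => //; apply: (le_trans _ (IHk (ltnW kn))).
  by rewrite ler_piMr.
rewrite -mulrDl ler_pM2r ?invr_gt0// -natrD ler_nat.
by rewrite -mulnSr leq_mul.
Qed.

(** Under the Polya urn weights the mean of C(j,k) / C(n,k) is exactly the Beta moment. Replacing
    the ratio by (j / n)^k costs O(1 / n) and leaves a mean of values of the polynomial on [0, 1],
    so - L <= C / n for all large n. *)
Lemma beta_moments_ge0 a b (u : nat -> R) d : 0 <= a -> 0 <= b -> a + b = 1 ->
  (forall s : R, 0 <= s <= 1 -> 0 <= \sum_(k < d) u k * s ^+ k) ->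
  0 <= \sum_(k < d) u k * risbin a k.
Proof.
move=> a0 b0 ab1 u0; rewrite leNgt; apply/negP => neg.
set L := \sum_(k < d) _ in neg.
pose C := \sum_(k < d) `|u k| * (k * k)%:R.
have bound n : (0 < n)%N -> (d <= n)%N -> - L <= C / n%:R.
  move=> n0 dn; pose w j := risbin a j * risbin b (n - j).
  have w_ge0 j : 0 <= w j by rewrite mulr_ge0 ?risbin_ge0.
  have w_sum : \sum_(j < n.+1) w j = 1 by rewrite risbin_conv ab1 risbin1.
  have LE : L = \sum_(j < n.+1) w j *
      \sum_(k < d) u k * ('C(j, k)%:R / 'C(n, k)%:R).
    under eq_bigr do rewrite mulr_sumr; rewrite exchange_big/=; apply: eq_bigr => k _.
    have kn : (k <= n)%N by apply: ltnW; apply: leq_trans dn.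
    have Cnk : 'C(n, k)%:R != 0 :> R by rewrite pnatr_eq0 -lt0n bin_gt0.
    rewrite -(mulfK Cnk (risbin a k)) -(polya_moment ab1 kn) mulr_suml mulr_sumr.
    by apply: eq_bigr => j _; rewrite /w; ring.
  have -> : C / n%:R = \sum_(j < n.+1) w j * (C / n%:R).
    by rewrite -mulr_suml w_sum mul1r.
  rewrite LE -sumrN; apply: ler_sum => j _.
  rewrite -mulrN; apply: ler_wpM2l => //.
  have x01 : 0 <= (j%:R / n%:R : R) <= 1.
    by rewrite divr_ge0//= ler_pdivrMr ?ltr0n// mul1r ler_nat -ltnS.
  have px0 := u0 _ x01.
  rewrite -subr_ge0 opprK /C mulr_suml -big_split/=.
  apply: (le_trans px0); apply: ler_sum => k _.
  have kn : (k <= n)%N by apply: ltnW; apply: leq_trans dn.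
  have jn : (j <= n)%N by rewrite -ltnS.
  rewrite -lerBlDr -mulrBr; apply: (le_trans (ler_norm _)).
  by rewrite normrM -mulrA ler_wpM2l// ffact_pow_dist.
(* An index at least d and larger than C / - L, where [bound] fails. *)
set M := (Num.bound (C / - L) + d).+1.
have M0 : 0 < M%:R :> R by rewrite ltr0n.
have L0 : 0 < - L by rewrite oppr_gt0.
have := bound M isT (leqW (leq_addl _ _)).
rewrite leNgt ltr_pdivrMr// mulrC -ltr_pdivrMr// => /negP[].
have C0 : 0 <= C by apply: sumr_ge0 => k _; rewrite mulr_ge0.
rewrite (lt_le_trans (archi_boundP _)) ?divr_ge0 ?(ltW L0)//.
by rewrite ler_nat leqW// leq_addr.
Qed.

End BetaMoments.

(** * The convolution form of a Gram matrix *)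

Section ConvolutionForm.
Variables (R : realFieldType) (N : nat) (G : nat -> nat -> R).
Implicit Types (f h : {poly R}).

(* When [G] is the Gram matrix of [v], this is the sum over [n < N] of the inner
   products of the [n]-th terms of the convolutions of [f] and [h] with [v]. *)
Definition conv_form f h : R :=
  \sum_(n < N) \sum_(i < n.+1) \sum_(j < n.+1) f`_(n - i) * h`_(n - j) * G i j.

Lemma conv_formDl f1 f2 h : conv_form (f1 + f2) h = conv_form f1 h + conv_form f2 h.
Proof.
rewrite /conv_form -big_split/=; apply: eq_bigr => n _.
rewrite -big_split/=; apply: eq_bigr => i _.
by rewrite -big_split/=; apply: eq_bigr => j _; rewrite coefD !mulrDl.
Qed.

Lemma conv_formZl a f h : conv_form (a *: f) h = a * conv_form f h.
Proof.
rewrite /conv_form mulr_sumr; apply: eq_bigr => n _.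
rewrite mulr_sumr; apply: eq_bigr => i _.
by rewrite mulr_sumr; apply: eq_bigr => j _; rewrite coefZ !mulrA.
Qed.

Hypothesis Gsym : forall i j, G i j = G j i.
Hypothesis Gpos : forall n (x : nat -> R),
  0 <= \sum_(i < n) \sum_(j < n) x i * x j * G i j.

Lemma conv_formC f h : conv_form f h = conv_form h f.
Proof.
apply: eq_bigr => n _; rewrite exchange_big/=; apply: eq_bigr => i _.
by apply: eq_bigr => j _; rewrite Gsym [f`_ _ * _]mulrC.
Qed.

Lemma conv_form_ge0 f : 0 <= conv_form f f.
Proof. by apply: sumr_ge0 => n _; apply: (Gpos _ (fun i => f`_(n - i))). Qed.

(** Multiplication by X delays the convolution by one step: a zero term enters at the front, and the
    last term, nonnegative by [Gpos], drops out. *)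
Lemma conv_form_mulX f : conv_form ('X * f) ('X * f) <= conv_form f f.
Proof.
rewrite /conv_form; case: N => [|M]; first by rewrite !big_ord0.
rewrite big_ord_recl big_ord1 big_ord1 !coefXM !mul0r add0r big_ord_recr/=.
rewrite -[leLHS]addr0 lerD//; last exact: (Gpos _ (fun i => f`_(M - i))).
apply: ler_sum => n _; rewrite /bump/= add1n big_ord_recr/=.
rewrite [X in _ + X]big1 ?addr0; last first.
  by move=> j _; rewrite subnn coefXM !mul0r.
apply: ler_sum => i _; rewrite big_ord_recr/= [('X * f)`_(_ - n.+1)]coefXM subnn.
rewrite mulr0 mul0r addr0; apply: ler_sum => j _.
by rewrite !coefXM !subSn -1?ltnS.
Qed.

Lemma conv_form_mod f f' h h' : 'X^N %| f - f' -> 'X^N %| h - h' ->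
  conv_form f h = conv_form f' h'.
Proof.
have coef_mod (u u' : {poly R}) k : 'X^N %| u - u' -> (k < N)%N -> u`_k = u'`_k.
  move=> /dvdpP[w uw] kN; apply/eqP; rewrite -subr_eq0 -coefB uw coefMXn kN//.
move=> ff' hh'; apply: eq_bigr => n _; apply: eq_bigr => i _; apply: eq_bigr => j _.
by rewrite (coef_mod _ _ _ ff') ?(coef_mod _ _ _ hh')//;
  apply: leq_ltn_trans (ltn_ord n); apply: leq_subr.
Qed.

(** Convolving 1 with a sequence gives the sequence back, which turns the form into the sum of the
    theorem. *)
Lemma conv_form1 f :
  conv_form f 1 = \sum_(n < N) \sum_(j < n.+1) f`_j * G (n - j)%N n.
Proof.
apply: eq_bigr => n _; rewrite [RHS](reindex_inj rev_ord_inj)/=; apply: eq_bigr => i _.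
rewrite big_ord_recr/= big1 ?add0r; last first.
  by move=> j _; rewrite coef1 subn_eq0 leqNgt ltn_ord mulr0 mul0r.
by rewrite subnn coef1 mulr1 subSS subKn// -ltnS.
Qed.

End ConvolutionForm.

(** * Positivity certificates for a contraction *)

Section Accretive.
Variables (R : realFieldType) (B : {poly R} -> {poly R} -> R) (z : {poly R}).
Hypothesis BDl : forall f g h, B (f + g) h = B f h + B g h.
Hypothesis BZl : forall a f h, B (a *: f) h = a * B f h.
Hypothesis BC : forall f h, B f h = B h f.
Hypothesis B_ge0 : forall f, 0 <= B f f.
Hypothesis B_mulz : forall f, B (z * f) (z * f) <= B f f.

Lemma BDr f g h : B h (f + g) = B h f + B h g.
Proof. by rewrite BC BDl ![B _ h]BC. Qed.

Lemma BZr a f h : B h (a *: f) = a * B h f.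
Proof. by rewrite BC BZl [B _ h]BC. Qed.

Lemma B_den_ge0 f : 0 <= B f (4 *: f - 4 *: (z * f) + z ^+ 2 * f).
Proof.
set e1 := z * f; set e2 := z ^+ 2 * f.
have ze1 : z * e1 = e2 by rewrite /e1 /e2; ring.
(* On |z| = 1 with c = Re z, Re (4 - 4 z + z^2) = 2 (1 - c)^2 + 1 = |1 - z|^4 / 2 + 1, whence [s1]
   and [s2]. The form is exactly (s1 + c1 + c2) / 2 + s2, with [c1] and [c2] read as differences of
   their sides. *)
have s1 := B_ge0 (f + (-2) *: e1 + e2).
have s2 := B_ge0 f.
have c1 := B_mulz f; have c2 := B_mulz ((-2) *: f + e1).
move: s1 s2 c1 c2; rewrite -scaleNr !(mulrDr, =^~scalerAr) -/e1 ze1 !BDl !BZl !BDr !BZr.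
rewrite (BC e1 f) (BC e2 f) (BC e2 e1).
lra.
Qed.

Lemma B_bdf_ge0 f :
  0 <= B (137 *: f + (-300) *: (z * f) + 300 *: (z ^+ 2 * f)
          + (-200) *: (z ^+ 3 * f) + 75 *: (z ^+ 4 * f) + (-12) *: (z ^+ 5 * f))
         (4 *: f - 4 *: (z * f) + z ^+ 2 * f).
Proof.
set e1 := z * f; set e2 := z ^+ 2 * f; set e3 := z ^+ 3 * f.
set e4 := z ^+ 4 * f; set e5 := z ^+ 5 * f.
have ze1 : z * e1 = e2 by rewrite /e1 /e2; ring.
have ze2 : z * e2 = e3 by rewrite /e2 /e3; ring.
have ze3 : z * e3 = e4 by rewrite /e3 /e4; ring.
have ze4 : z * e4 = e5 by rewrite /e4 /e5; ring.
have sym := (BC e1 f, BC e2 f, BC e3 f, BC e4 f, BC e5 f, BC e2 e1, BC e3 e1,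
  BC e4 e1, BC e5 e1, BC e3 e2, BC e4 e2, BC e5 e2, BC e4 e3, BC e5 e3, BC e5 e4).
(* On [|z| = 1] with [c = Re z], [Re (60 P * conj (4 D))] is
   [(1 - c) * (768 * (c^2 - 21/16 * c + 1/12)^2 + 21 * c^2 + 536/3)]. The squares
   [s1], [s2], [s3] are its three terms; [c1] to [c7] come from a decomposition of
   the remaining positive matrix of the storage function. *)
have s1 := B_ge0 (24 *: f + (-87) *: e1 + 119 *: e2 + (-119) *: e3
                  + 87 *: e4 + (-24) *: e5).
rewrite !BDl !BZl !BDr !BZr !sym in s1.
have s2 := B_ge0 (f + (-1) *: e1 + e2 + (-1) *: e3).
rewrite !BDl !BZl !BDr !BZr !sym in s2.
have s3 := B_ge0 (f + (-1) *: e1).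
rewrite !BDl !BZl !BDr !BZr !sym in s3.
have c1 := B_mulz (63 *: f + (-113) *: e1 + 119 *: e2 + (-87) *: e3 + 24 *: e4).
rewrite !(mulrDr, =^~scalerAr) -/e1 ?ze1 ?ze2 ?ze3 ?ze4 !BDl !BZl !BDr !BZr !sym in c1.
have c2 := B_mulz ((-200) *: f + 413 *: e1 + (-348) *: e2 + 96 *: e3).
rewrite !(mulrDr, =^~scalerAr) -/e1 ?ze1 ?ze2 ?ze3 ?ze4 !BDl !BZl !BDr !BZr !sym in c2.
have c3 := B_mulz (2 *: f + (-2) *: e1 + e2).
rewrite !(mulrDr, =^~scalerAr) -/e1 ?ze1 ?ze2 ?ze3 ?ze4 !BDl !BZl !BDr !BZr !sym in c3.
have c4 := B_mulz (2 *: f + (-3) *: e1 + e2).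
rewrite !(mulrDr, =^~scalerAr) -/e1 ?ze1 ?ze2 ?ze3 ?ze4 !BDl !BZl !BDr !BZr !sym in c4.
have c5 := B_mulz (4 *: f + (-3) *: e1).
rewrite !(mulrDr, =^~scalerAr) -/e1 ?ze1 ?ze2 ?ze3 ?ze4 !BDl !BZl !BDr !BZr !sym in c5.
have c6 := B_mulz (f + (-1) *: e1).
rewrite !(mulrDr, =^~scalerAr) -/e1 ?ze1 ?ze2 ?ze3 ?ze4 !BDl !BZl !BDr !BZr !sym in c6.
have c7 := B_mulz f; rewrite -/e1 in c7.
rewrite -scaleNr !BDl !BZl !BDr !BZr !sym; lra.
Qed.

End Accretive.

(** * Positivity for the BDF symbol, first at fixed s, then averaged over s *)

Section SymbolPositivity.
Variables (R : archiRealFieldType) (rho : R).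

Definition bdf_poly : {poly R} :=
  \sum_(1 <= j < 6) j%:R^-1 *: (1 - rho *: 'X) ^+ j.

Definition den_poly : {poly R} := (1 - (rho / 2) *: 'X) ^+ 2.

(** The series w of the overview; p0 = 137/60 = 1 + 1/2 + 1/3 + 1/4 + 1/5 is P(0). *)
Definition bdf_defect : {poly R} := 1 - (60 / 137) *: bdf_poly.

(** The factor 60 clears the denominators, to match [B_bdf_ge0]. *)
Lemma bdf_polyE f : 60 *: (bdf_poly * f) =
  137 *: f + (-300) *: (rho *: 'X * f) + 300 *: ((rho *: 'X) ^+ 2 * f)
  + (-200) *: ((rho *: 'X) ^+ 3 * f) + 75 *: ((rho *: 'X) ^+ 4 * f)
  + (-12) *: ((rho *: 'X) ^+ 5 * f).
Proof.
rewrite /bdf_poly unlock /=; set z := rho *: 'X.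
have -> : 60 *: (((1%:R^-1 *: (1 - z) ^+ 1 + (2%:R^-1 *: (1 - z) ^+ 2
  + (3%:R^-1 *: (1 - z) ^+ 3 + (4%:R^-1 *: (1 - z) ^+ 4
  + (5%:R^-1 *: (1 - z) ^+ 5 + 0)))))) * f) =
  (60 / 1%:R) *: ((1 - z) ^+ 1 * f) + (60 / 2) *: ((1 - z) ^+ 2 * f)
  + (60 / 3) *: ((1 - z) ^+ 3 * f) + (60 / 4) *: ((1 - z) ^+ 4 * f)
  + (60 / 5) *: ((1 - z) ^+ 5 * f).
  move: (1 - z) => x.
  by rewrite -!scalerA -!scalerDr !mulrDl -!scalerAl mul0r addr0 !addrA.
have -> : 60 / 1%:R = 60 :> R by field.
have -> : 60 / 2 = 30 :> R by field.
have -> : 60 / 3 = 20 :> R by field.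
have -> : 60 / 4 = 15 :> R by field.
have -> : 60 / 5 = 12 :> R by field.
by rewrite -!mul_polyC !polyCN !polyC_natr; ring.
Qed.

Lemma den_polyE f :
  4 *: (den_poly * f) = 4 *: f - 4 *: (rho *: 'X * f) + (rho *: 'X) ^+ 2 * f.
Proof.
have E : 2 *: (1 - (rho / 2) *: 'X) = 2 - rho *: 'X :> {poly R}.
  by rewrite scalerBr scalerA mulrC divfK ?pnatr_eq0// scaler_nat.
have -> : 4 = 2 ^+ 2 :> R by ring.
rewrite scalerAl -exprZn E -!mul_polyC rmorphXn/= polyC_natr; ring.
Qed.

Lemma dvdX_defect : 'X %| bdf_defect.
Proof.
rewrite -['X]subr0 dvdp_XsubCl /root /bdf_defect !hornerE.
have := congr1 (fun p => p.[0]) (bdf_polyE 1).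
rewrite !(mulr1, hornerE, hornerZ, expr0n)/= => E; apply/eqP.
lra.
Qed.

Variables (N : nat) (G : nat -> nat -> R).
Hypothesis Gsym : forall i j, G i j = G j i.
Hypothesis Gpos : forall n (x : nat -> R),
  0 <= \sum_(i < n) \sum_(j < n) x i * x j * G i j.
Hypothesis rho01 : 0 <= rho <= 1.

Notation B := (conv_form N G).

Lemma conv_form_contract f : B (rho *: 'X * f) (rho *: 'X * f) <= B f f.
Proof.
rewrite -scalerAl conv_formZl (conv_formC N Gsym) conv_formZl mulrA.
case/andP: rho01 => r0 r1; apply: le_trans (conv_form_mulX N Gpos f).
by rewrite ler_piMl ?conv_form_ge0// mulr_ile1.
Qed.

Let w := bdf_defect.

Lemma symbol_resolvent_ge0 (A : {poly R}) (s : R) : 'X^N %| A * den_poly - 1 ->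
  0 <= s <= 1 -> 0 <= \sum_(k < N) B (A * (1 - w) * w ^+ k) 1 * s ^+ k.
Proof.
move=> AD /andP[s0 s1].
pose Y := A * \sum_(k < N) (s *: w) ^+ k; pose U := (1 - w) * Y.
have B0l : B 0 1 = 0 by rewrite -(scale0r 0) conv_formZl mul0r.
have -> : \sum_(k < N) B (A * (1 - w) * w ^+ k) 1 * s ^+ k = B U 1.
  rewrite /U /Y mulrCA 2!mulr_sumr.
  rewrite (big_morph (B^~ 1) (fun f g => conv_formDl N G f g _) B0l).
  by apply: eq_bigr => k _; rewrite exprZn -!scalerAr conv_formZl mulrA mulrC.
(* Since s (1 - w) + (1 - s) = 1 - s w, the new argument is D (1 - s w) Y. It is 1 modulo X^N: [A]
   inverts D there, and the geometric sum inverts 1 - s w up to (s w)^N, a multiple of X^N because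
   w(0) = 0. *)
have -> : B U 1 = B U (s *: (den_poly * U) + (1 - s) *: (den_poly * Y)).
  apply: conv_form_mod; first by rewrite subrr dvdp0.
  rewrite -dvdpNr opprB /U /Y.
  have -> : s *: (den_poly * ((1 - w) * (A * \sum_(k < N) (s *: w) ^+ k)))
      + (1 - s) *: (den_poly * (A * \sum_(k < N) (s *: w) ^+ k)) - 1
    = A * den_poly * (- ((s *: w - 1) * \sum_(k < N) (s *: w) ^+ k)) - 1.
    by rewrite -!mul_polyC; ring.
  rewrite -subrX1 opprB mulrBr mulr1 addrAC dvdp_sub// exprZn.
  by rewrite -mul_polyC; apply/dvdp_mull/dvdp_mull/dvdp_exp2r/dvdX_defect.
rewrite (conv_formC N Gsym) conv_formDl !conv_formZl.
have B_den f := B_den_ge0 (@conv_formDl _ N G) (@conv_formZl _ N G) (conv_formC N Gsym)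
  (conv_form_ge0 N Gpos) conv_form_contract f.
have B_bdf f := B_bdf_ge0 (@conv_formDl _ N G) (@conv_formZl _ N G) (conv_formC N Gsym)
  (conv_form_ge0 N Gpos) conv_form_contract f.
have UDU := B_den U; have PYDY := B_bdf Y.
move: UDU PYDY; rewrite -bdf_polyE -!den_polyE.
(* As P Y is a positive multiple of U, [B_bdf] yields B(U, D Y) >= 0. *)
have -> : bdf_poly * Y = (137 / 60) *: U.
  rewrite /U /w /bdf_defect opprB addrC subrK -scalerAl scalerA.
  by have -> : 137 / 60 * (60 / 137) = 1 :> R; [field|rewrite scale1r].
rewrite scalerA !(conv_formC N Gsym _ (4 *: _)) !conv_formZl.
rewrite (conv_formC N Gsym _ (_ *: U)) conv_formZl (conv_formC N Gsym U) => UDU PYDY.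
rewrite addr_ge0// mulr_ge0 ?subr_ge0//; lra.
Qed.

(** By linearity the form at s is a polynomial in s; [beta_moments_ge0] replaces its powers of s by
    the moments. *)
Lemma symbol_pow_ge0 (A : {poly R}) (alpha : R) : 'X^N %| A * den_poly - 1 ->
  0 <= alpha <= 1 ->
  0 <= B (A * ((1 - w) * \sum_(k < N) risbin (1 - alpha) k *: w ^+ k)) 1.
Proof.
move=> AD /andP[a0 a1].
have B0l : B 0 1 = 0 by rewrite -(scale0r 0) conv_formZl mul0r.
rewrite mulrA mulr_sumr (big_morph (B^~ 1) (fun f g => conv_formDl N G f g _) B0l).
under eq_bigr do rewrite -scalerAr conv_formZl mulrC.
apply: (@beta_moments_ge0 _ (1 - alpha) alpha
  (fun k => B (A * (1 - w) * w ^+ k) 1)); rewrite ?subr_ge0 ?subrK//.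
by move=> s s01; apply: symbol_resolvent_ge0.
Qed.

End SymbolPositivity.

(** * Error of the truncated binomial series *)

Section BinomialSeries.
Variable R : realType.
Implicit Types a x : R.

Definition risbin_poly a N : {poly R} := \sum_(k < N) risbin a k *: 'X^k.

(** The function y = (1 - x)^(-a) solves (1 - x) y' = a y; truncating its series leaves a single
    monomial. For N = 0 the factor N%:R kills it. *)
Lemma risbin_poly_ode a N :
  (1 - 'X) * (risbin_poly a N)^`() - a *: risbin_poly a N
  = - (N%:R * risbin a N) *: 'X^(N.-1).
Proof.
elim: N => [|N IHN].
  by rewrite /risbin_poly big_ord0 deriv0 mulr0 scaler0 subr0 mul0r oppr0 scale0r.
rewrite /risbin_poly big_ord_recr/= -/(risbin_poly a N) derivD derivZ derivXn.
have -> : (1 - 'X) * ((risbin_poly a N)^`() + risbin a N *: ('X^(N.-1) *+ N))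
    - a *: (risbin_poly a N + risbin a N *: 'X^N)
  = ((1 - 'X) * (risbin_poly a N)^`() - a *: risbin_poly a N)
    + ((1 - 'X) * (risbin a N *: ('X^(N.-1) *+ N)) - a *: (risbin a N *: 'X^N)).
  by rewrite scalerDr; ring.
rewrite IHN risbinSm; case: N {IHN} => [|N] /=.
  by rewrite mulr0n mul0r oppr0 scale0r !scaler0 mulr0 !add0r scalerA scaleNr.
rewrite -['X^N *+ _]scaler_nat scalerA mulrBl mul1r -scalerAr -exprS !scalerA.
rewrite [risbin _ _ * _]mulrC.
rewrite scaleNr !addrA addNr add0r -scaleNr -scalerBl; congr (_ *: _); ring.
Qed.

(** By [risbin_poly_ode] the derivative of (1 - t)^a M(t) is a multiple of t^(N - 1) (1 - t)^(a -
    1). The value at 0 is 1, and the mean value theorem bounds the deviation. *)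
Lemma powR_risbin_poly a N x : (0 < N)%N -> 0 < a <= 1 -> 0 <= x <= 2^-1 ->
  `|(1 - x) `^ a * (risbin_poly a N).[x] - 1| <= 2 * N%:R * risbin a N * x ^+ N.
Proof.
case: N => [//|N] _ /andP[a0 a1] /andP[x0 x1].
set M := risbin_poly a N.+1.
pose df (t : R) : R := (1 - t) `^ (a - 1) * (- (N.+1%:R * risbin a N.+1) * t ^+ N).
have dphi (t : R) : t < 1 ->
    is_derive t 1 (fun t : R => (1 - t) `^ a * M.[t]) (df t).
  move=> t1.
  have D1 : is_derive t 1 (fun t : R => 1 - t) (-1).
    by rewrite -[X in is_derive _ _ _ X]add0r; apply: is_deriveB.
  have t1' : 0 < 1 - t by rewrite subr_gt0.
  have D2 := @is_derive1_comp _ (fun y : R => y `^ a) (fun t : R => 1 - t) t _ _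
    (is_derive1_powR a t1') D1.
  have D3 := is_deriveM D2 (is_derive_poly M t).
  apply: is_derive_eq D3 _.
  have := congr1 (fun p => p.[t]) (risbin_poly_ode a N.+1).
  rewrite -/M !hornerE/= /df => <-.
  have <- : (1 - t) * (1 - t) `^ (a - 1) = (1 - t) `^ a by rewrite mulr_powRB1// ltW.
  by rewrite /GRing.scale/=; ring.
have [c cI] : exists2 c, c \in `[0, x]%R &
    (1 - x) `^ a * M.[x] - (1 - 0) `^ a * M.[0] = df c * (x - 0).
  apply: (@MVT_segment _ (fun t : R => (1 - t) `^ a * M.[t])) => //.
    by move=> t; rewrite in_itv/= => /andP[_ tx]; apply: dphi; lra.
  apply: derivable_within_continuous => t; rewrite in_itv/= => /andP[_ tx].
  by apply: ex_derive; apply: dphi; lra.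
have -> : (1 - 0) `^ a * M.[0] = 1.
  rewrite subr0 powR1 mul1r /M /risbin_poly big_ord_recl risbin0 scale1r expr0.
  rewrite hornerD hornerC horner_sum big1 ?addr0// => k _.
  by rewrite hornerZ hornerXn expr0n mulr0.
rewrite subr0 => ->; move: cI; rewrite in_itv/= => /andP[c0 cx].
have b1 : (1 - c) `^ (a - 1) <= 2.
  apply: (@le_trans _ _ ((1 - c) `^ (-1))).
    apply: ger_powR; lra.
  rewrite powR_inv1; last lra.
  rewrite -[leRHS]invrK lef_pV2 ?posrE; lra.
have b2 : c ^+ N <= x ^+ N by rewrite lerXn2r.
have m0 : 0 <= risbin a N.+1 by rewrite risbin_ge0// ltW.
rewrite /df mulNr mulrN mulNr normrN ger0_norm; last first.
  by rewrite !mulr_ge0// ?powR_ge0// exprn_ge0.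
rewrite exprSr !mulrA ler_wpM2r// -!mulrA ler_pM ?powR_ge0//.
  by rewrite !mulr_ge0// exprn_ge0.
by rewrite ler_wpM2l// ler_wpM2l.
Qed.

(** Since (1 - x)^a = (1 - x) (1 - x)^(-(1 - a)), this is the previous bound at 1 - a, multiplied by
    (1 - x)^a <= 1. *)
Lemma powR_taylor a N x : (0 < N)%N -> 0 <= a < 1 -> 0 <= x <= 2^-1 ->
  `|(1 - x) `^ a - (1 - x) * (risbin_poly (1 - a) N).[x]|
  <= 2 * N%:R * risbin (1 - a) N * x ^+ N.
Proof.
move=> N0 /andP[a0 a1] x01; have /andP[x0 x1] := x01.
have := @powR_risbin_poly (1 - a) N x N0.
rewrite subr_gt0 a1 gerBl a0 x01 => /(_ isT isT).
set M := _.[x] => le1; rewrite distrC.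
have -> : (1 - x) * M - (1 - x) `^ a = (1 - x) `^ a * ((1 - x) `^ (1 - a) * M - 1).
  have {1}-> : 1 - x = (1 - x) `^ a * (1 - x) `^ (1 - a).
    rewrite -powRD; last by apply/implyP => _; lra.
    by rewrite [a + _]addrC subrK powRr1//; lra.
  by ring.
rewrite normrM; apply: le_trans le1; rewrite ler_piMl// ger0_norm ?powR_ge0//.
rewrite -[leRHS](congr1 (fun f => f a) (powR1 R)).
by apply: ge0_ler_powR => //; rewrite ?nnegrE; lra.
Qed.

End BinomialSeries.

(** * From estimates near 0 to congruences modulo X^N *)

Section Expansion.
Variable R : realType.

Lemma horner_bound (p : {poly R}) x : 0 <= x <= 1 ->
  `|p.[x]| <= \sum_(i < size p) `|p`_i|.
Proof.
move=> /andP[x0 x1]; rewrite horner_coef; apply: (le_trans (ler_norm_sum _ _ _)).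
apply: ler_sum => i _; rewrite normrM ler_piMr// ger0_norm ?exprn_ge0//.
by rewrite exprn_ile1.
Qed.

(** Inductively p = q X^N with |q(x)| <= |C| x; as q(x) - q(0) is also O(x), letting x tend to 0
    gives q(0) = 0. *)
Lemma dvdXn_littleo (p : {poly R}) N (C d : R) : 0 < d ->
  (forall x, 0 < x < d -> `|p.[x]| <= C * x ^+ N) -> 'X^N %| p.
Proof.
elim: N C d => [|N IHN] C d d0 pC; first by rewrite expr0 dvd1p.
pose e := Num.min d 1.
have e0 : 0 < e by rewrite lt_min d0 ltr01.
have : 'X^N %| p.
  apply: (IHN `|C| e e0) => x; rewrite lt_min => /and3P[x0 xd x1].
  have := pC x; rewrite x0 xd => /(_ isT) /le_trans; apply.
  apply: (@le_trans _ _ (`|C| * x ^+ N.+1)).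
    by rewrite ler_wpM2r ?ler_norm// exprn_ge0// ltW.
  by rewrite ler_wpM2l// exprS ler_piMl ?exprn_ge0// ltW.
move=> /dvdpP[q pq].
rewrite pq exprS dvdp_mul// -['X]subr0 dvdp_XsubCl; apply/negPn/negP => q0.
have : 'X %| q - q.[0]%:P by rewrite -['X]subr0 dvdp_XsubCl /root !hornerE subrr.
move=> /dvdpP[r qr].
pose K := \sum_(i < size r) `|r`_i|.
have q0' : 0 < `|q.[0]| by rewrite normr_gt0.
have bound x : 0 < x < e -> `|q.[0]| <= (`|C| + K) * x.
  rewrite lt_min => /and3P[x0 xd x1].
  have xN : 0 < x ^+ N by rewrite exprn_gt0.
  have : `|q.[x]| <= `|C| * x.
    rewrite -(ler_pM2r xN) -mulrA -exprS -{1}(ger0_norm (ltW xN)) -normrM.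
    have := pC x; rewrite x0 xd pq !hornerE => /(_ isT) /le_trans; apply.
    by rewrite ler_wpM2r ?ler_norm// exprn_ge0// ltW.
  have : q.[x] - q.[0] = r.[x] * x.
    by have := congr1 (fun u => u.[x]) qr; rewrite !hornerE.
  have : `|r.[x]| <= K by apply: horner_bound; rewrite !ltW.
  move=> rK qx qC; have -> : q.[0] = q.[x] - r.[x] * x by rewrite -qx; ring.
  apply: (le_trans (ler_normB _ _)); rewrite normrM (gtr0_norm x0) mulrDl lerD//.
  by rewrite ler_wpM2r// ltW.
have K0 : 0 <= `|C| + K by rewrite addr_ge0// sumr_ge0.
(* Here (|C| + K) x <= |q(0)| / 2, against [bound]; the + 1 keeps the denominator positive. *)
pose x := Num.min (e / 2) (`|q.[0]| / 2 / (`|C| + K + 1)).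
have x0 : 0 < x by rewrite lt_min !divr_gt0// ltr_pwDr.
have xe : x < e by rewrite gt_min; apply/orP; left; lra.
have := bound x; rewrite x0 xe => /(_ isT).
have : x <= `|q.[0]| / 2 / (`|C| + K + 1) by rewrite ge_min lexx orbT.
rewrite ler_pdivlMr ?ltr_pwDr//; nra.
Qed.

(** Convergence at x0 bounds |g_j x0^j| by some M, so the tail is dominated by a geometric series of
    ratio x / x0 <= 1/2. *)
Lemma pseries_remainder (g : nat -> R) (x0 : R) N : 0 < x0 -> cvgn (pseries g x0) ->
  exists C, forall x l, 0 < x <= x0 / 2 -> (pseries g x @ \oo --> l)%classic ->
    `|l - (\poly_(j < N) g j).[x]| <= C * x ^+ N.
Proof.
move=> x00 /cvg_series_bounded [M0 [_ /(_ (`|M0| + 1))]].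
rewrite ltr_pwDr// ?ler_norm// => /(_ isT) gM; set M := `|M0| + 1 in gM.
have M_ge0 : 0 <= M by rewrite addr_ge0.
exists (2 * M / x0 ^+ N) => x l /andP[x_gt0 xx0] gl.
have lim_bound : forall n, (N <= n)%N ->
    `|pseries g x n - (\poly_(j < N) g j).[x]| <= 2 * M / x0 ^+ N * x ^+ N.
  move=> n Nn.
  have -> : pseries g x n - (\poly_(j < N) g j).[x] = \sum_(N <= j < n) g j * x ^+ j.
    rewrite /pseries /series/= (big_cat_nat _ Nn)//= horner_poly -(big_mkord xpredT
      (fun j => g j * x ^+ j)); ring.
  apply: (le_trans (ler_norm_sum _ _ _)).
  pose r := x / x0.
  have r0 : 0 <= r by rewrite divr_ge0 ?ltW.
  have r1 : r <= 2^-1 by rewrite ler_pdivrMr// mulrC.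
  have term j : `|g j * x ^+ j| <= M * r ^+ j.
    have -> : g j * x ^+ j = (g j * x0 ^+ j) * r ^+ j.
      by rewrite /r expr_div_n -mulrA [x0 ^+ j * _]mulrC divfK// expf_neq0// gt_eqF.
    by rewrite normrM (ger0_norm (exprn_ge0 _ r0)) ler_wpM2r ?exprn_ge0//; apply: gM.
  apply: (@le_trans _ _ (\sum_(N <= j < n) M * r ^+ j)); first exact: ler_sum.
  have -> : 2 * M / x0 ^+ N * x ^+ N = M * (2 * r ^+ N).
    by rewrite /r expr_div_n; ring.
  rewrite -mulr_sumr ler_wpM2l//.
  (* The subtracted term, exact for r = 1/2, lets the induction on n close. *)
  suff : \sum_(N <= j < n) r ^+ j <= 2 * r ^+ N - 2 * r ^+ n.
    by move=> /le_trans; apply; rewrite gerBl mulr_ge0// exprn_ge0.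
  elim: n Nn => [|n IHn]; first by rewrite leqn0 => /eqP ->; rewrite big_nil subrr.
  rewrite leq_eqVlt => /predU1P[<-|]; first by rewrite big_geq// subrr.
  rewrite ltnS => Nn; rewrite big_nat_recr//=.
  apply: (le_trans (lerD (IHn Nn) (lexx _))); rewrite exprS.
  have : 0 <= r ^+ n by rewrite exprn_ge0.
  nra.
set c := _.[x] in lim_bound *; set B := _ * _ in lim_bound *.
have cv : ((fun n => `|pseries g x n - c|) @ \oo --> `|l - c|)%classic.
  by apply: cvg_norm; apply: cvgB => //; exact: cvg_cst.
rewrite -(cvg_lim _ cv)//; apply: limr_le; first by apply/cvg_ex; exists `|l - c|.
by near=> n; apply: lim_bound; near: n; exists N.
Unshelve. all: by end_near.
Qed.

End Expansion.

(** * The Toeplitz form of the coefficients q *)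

Section Toeplitz.
Variables (R : realType) (alpha sigma tau : R) (g : nat -> R).
Hypotheses (alpha_gt0 : 0 < alpha) (alpha_lt1 : alpha < 1).
Hypotheses (sigma_ge0 : 0 <= sigma) (tau_gt0 : 0 < tau).
Hypothesis g_def : is_g 5 alpha sigma tau g.

Let rho := expR (- (sigma * tau)).

Let rho01 : 0 <= rho <= 1.
Proof. by rewrite expR_ge0 -expR0 ler_expR oppr_le0 mulr_ge0// ltW. Qed.

Lemma bdf_symbolE x : bdf_symbol 5 sigma tau x = (bdf_poly rho).[x].
Proof.
rewrite /bdf_symbol /bdf_poly horner_sum; apply: eq_bigr => j _.
by rewrite !hornerE.
Qed.

(** With t = rho x, Bernoulli's inequality 1 - j t <= (1 - t)^j <= 1 gives 0 <= w <= (60 / 137) 5 t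
    <= 3 x. *)
Lemma bdf_defect_bound x : 0 <= x <= 1 -> 0 <= (bdf_defect rho).[x] <= 3 * x.
Proof.
move=> /andP[x0 x1]; have /andP[r0 r1] := rho01.
have tx : rho * x <= x by rewrite ler_piMl.
have t0 : 0 <= rho * x by rewrite mulr_ge0.
have bern j : 1 - j%:R * (rho * x) <= (1 - rho * x) ^+ j <= 1.
  elim: j => [|j /andP[IH1 IH2]]; first by rewrite mul0r subr0 expr0 lexx.
  rewrite exprSr -natr1; move: IH1 IH2; set u := _ ^+ j; set t := rho * x in t0 tx *.
  have j0 : 0 <= j%:R :> R by []; nra.
have := (bern 1%N, bern 2%N, bern 3%N, bern 4%N, bern 5%N).
rewrite /bdf_defect hornerD hornerN hornerZ hornerC -bdf_symbolE /bdf_symbol -/rho.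
rewrite 5?big_nat_recr//= big_geq// add0r.
set t := rho * x in t0 tx *.
move=> [[[[/andP[a1 b1] /andP[a2 b2]] /andP[a3 b3]] /andP[a4 b4]] /andP[a5 b5]].
lra.
Qed.

(** Both polynomials equal P(x)^alpha up to O(x^N) as x decreases to 0: one by the binomial series
    in w, the other by the definition of g. *)
Lemma symbol_truncation N : (0 < N)%N ->
  'X^N %| (137 / 60) `^ alpha *: ((1 - bdf_defect rho)
      * \sum_(k < N) risbin (1 - alpha) k *: bdf_defect rho ^+ k)
    - \poly_(j < N) g j.
Proof.
move=> N0; have /nbhs_ballP[d /= d0 gl] := g_def.
have gl' x : 0 < x < d ->
    (pseries g x @ \oo --> bdf_symbol 5 sigma tau x `^ alpha)%classic.
  move=> /andP[x0 xd]; apply: gl.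
  by rewrite /ball/= sub0r normrN gtr0_norm.
have d20 : 0 < d / 2 by lra.
have [|C gC] := @pseries_remainder _ g (d / 2) N d20.
  by apply/cvg_ex; eexists; apply: gl'; lra.
set c := _ `^ alpha; have c0 : 0 <= c by exact: powR_ge0.
pose K := c * (2 * N%:R * risbin (1 - alpha) N * 3 ^+ N).
(* Below d / 4 the point x is within half of the convergence point d / 2; below 1/6, w <= 3 x <=
   1/2. *)
apply: (@dvdXn_littleo _ _ _ (K + C) (Num.min (d / 4) (1 / 6))).
  by rewrite lt_min; lra.
move=> x; rewrite lt_min => /and3P[x0 xd x6].
have /bdf_defect_bound : 0 <= x <= 1 by lra.
move=> /andP[]; set w := (bdf_defect rho).[x] => w0 w3.
rewrite hornerD hornerN hornerZ hornerM hornerD hornerN hornerC -/w horner_sum.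
have -> : \sum_(i < N) (risbin (1 - alpha) i *: bdf_defect rho ^+ i).[x]
    = (risbin_poly (1 - alpha) N).[w].
  rewrite /risbin_poly horner_sum; apply: eq_bigr => i _.
  by rewrite !hornerZ hornerXn horner_exp.
have fE : bdf_symbol 5 sigma tau x `^ alpha = c * (1 - w) `^ alpha.
  rewrite -powRM; [|lra|lra]; congr (_ `^ _).
  rewrite bdf_symbolE /w /bdf_defect !hornerE opprB addrC subrK mulrA.
  by have -> : 137 / 60 * (60 / 137) = 1 :> R; [field|rewrite mul1r].
have b1 : `|c * (1 - w) `^ alpha - c * ((1 - w) * (risbin_poly (1 - alpha) N).[w])|
    <= K * x ^+ N.
  rewrite -mulrBr normrM (ger0_norm c0) /K -!mulrA ler_wpM2l//.
  have := @powR_taylor _ alpha N w N0; rewrite ltW// alpha_lt1 w0 => /(_ isT).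
  have w2 : w <= 2^-1 by lra.
  move=> /(_ w2) /le_trans; apply.
  have wN : w ^+ N <= 3 ^+ N * x ^+ N.
    by rewrite -exprMn lerXn2r ?nnegrE// (le_trans w0).
  by rewrite !mulrA -[leRHS]mulrA ler_wpM2l// !mulr_ge0// risbin_ge0// subr_ge0 ltW.
have b2 := gC x _ _ (gl' x _); rewrite fE in b2.
have -> : c * ((1 - w) * (risbin_poly (1 - alpha) N).[w]) - (\poly_(j < N) g j).[x]
  = (c * (1 - w) `^ alpha - (\poly_(j < N) g j).[x])
    - (c * (1 - w) `^ alpha - c * ((1 - w) * (risbin_poly (1 - alpha) N).[w])) by ring.
rewrite (mulrDl K) [K * _ + _]addrC; apply: (le_trans (ler_normB _ _)).
by rewrite lerD//; apply: b2; lra.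
Qed.

(** The truncated series of (1 - y)^(-2) at y = rho X / 2, that is, of 1 / D. *)
Definition den_inv N : {poly R} := \sum_(m < N) m.+1%:R *: ((rho / 2) *: 'X) ^+ m.

Lemma den_invP N : 'X^N %| den_inv N * den_poly rho - 1.
Proof.
rewrite /den_inv /den_poly; set y := _ *: 'X.
have -> : (\sum_(m < N) m.+1%:R *: y ^+ m) * (1 - y) ^+ 2 - 1
    = (N%:R * y - N.+1%:R) * y ^+ N.
  elim: N => [|N IHN]; first by rewrite big_ord0 expr0; ring.
  rewrite big_ord_recr/= mulrDl addrAC IHN scaler_nat -mulr_natl.
  by rewrite [y ^+ N.+1]exprS -!natr1; ring.
by apply: dvdp_mull; rewrite /y exprZn -mul_polyC; apply: dvdp_mull.
Qed.

Lemma coef_den_inv N k : (k < N)%N -> (den_inv N)`_k = k.+1%:R / 2 ^+ k * rho ^+ k.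
Proof.
move=> kN; rewrite /den_inv coef_sum (bigD1 (Ordinal kN))//= big1 ?addr0.
  by rewrite exprZn !coefZ coefXn eqxx mulr1 expr_div_n; ring.
move=> i; rewrite exprZn !coefZ coefXn -val_eqE/= eq_sym => /negbTE ->.
by rewrite !mulr0.
Qed.

Lemma q_polyE N :
  'X^N %| \poly_(j < N) q_coef sigma tau g j - den_inv N * \poly_(j < N) g j.
Proof.
set p := _ - _; rewrite -(poly_take_drop N p); have -> : take_poly N p = 0.
  apply/polyP => k; rewrite coef_take_poly coef0; case: ifP => // kN.
  rewrite coefB coef_poly kN coefM /q_coef big_mkord; apply/eqP; rewrite subr_eq0.
  apply/eqP/eq_bigr => m _; have mk : (m <= k)%N by rewrite -ltnS.
  rewrite coef_den_inv ?(leq_ltn_trans mk)// coef_poly.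
  rewrite (leq_ltn_trans (leq_subr _ _))// /rho -expRM_natl; congr (_ * expR _ * _).
  by rewrite -mulr_natr; ring.
by rewrite add0r dvdp_mull.
Qed.

Lemma q_toeplitz_ge0 (G : nat -> nat -> R) N :
  (forall i j, G i j = G j i) ->
  (forall n (x : nat -> R), 0 <= \sum_(i < n) \sum_(j < n) x i * x j * G i j) ->
  0 <= \sum_(n < N) \sum_(j < n.+1) q_coef sigma tau g j * G (n - j)%N n.
Proof.
move=> Gsym Gpos; case: (posnP N) => [->|N0]; first by rewrite big_ord0.
have -> : \sum_(n < N) \sum_(j < n.+1) q_coef sigma tau g j * G (n - j)%N n =
    conv_form N G (\poly_(j < N) q_coef sigma tau g j) 1.
  rewrite conv_form1; apply: eq_bigr => n _; apply: eq_bigr => j _.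
  by rewrite coef_poly (leq_trans (ltn_ord j))//.
pose S := (1 - bdf_defect rho) * \sum_(k < N) risbin (1 - alpha) k *: bdf_defect rho ^+ k.
rewrite (@conv_form_mod _ _ _ _ ((137 / 60) `^ alpha *: (den_inv N * S)) 1 1);
  last 2 first.
- have -> : \poly_(j < N) q_coef sigma tau g j - (137 / 60) `^ alpha *: (den_inv N * S)
    = (\poly_(j < N) q_coef sigma tau g j - den_inv N * \poly_(j < N) g j)
      - den_inv N * ((137 / 60) `^ alpha *: S - \poly_(j < N) g j).
    by rewrite -!mul_polyC; ring.
  by rewrite dvdp_sub ?q_polyE// dvdp_mull// symbol_truncation.
- by rewrite subrr dvdp0.
rewrite conv_formZl mulr_ge0 ?powR_ge0//.
by apply: symbol_pow_ge0 => //; [exact: den_invP | rewrite !ltW].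
Qed.

End Toeplitz.

(** * Real and complex Hilbert spaces *)

Lemma dot_self_ge0 (K : numDomainType) (U : lmodType K) (theta : K -> K)
  (dot : {dot U for theta}) u : 0 <= dot u u.
Proof.
have [->|u0] := eqVneq u 0; first by rewrite linear0l.
by rewrite ltW// neq0_dnorm_gt0.
Qed.

Lemma ReM_real (R : rcfType) (x : R) (z : R[i]) :
  complex.Re (x%:C * z) = x * complex.Re z.
Proof. by case: z => a b /=; rewrite mul0r subr0. Qed.

Lemma Re_conj (R : rcfType) (z : R[i]) : complex.Re (Num.conj z) = complex.Re z.
Proof. by case: z. Qed.

Theorem lemma3p7 (R : realType) (alpha sigma tau : R) (g : nat -> R)
    (alpha_gt0 : 0 < alpha) (alpha_lt1 : alpha < 1)
    (sigma_ge0 : 0 <= sigma) (tau_gt0 : 0 < tau)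
    (g_def : is_g 5 alpha sigma tau g) :
  (forall (H : completeNormedModType R) (dot : {dot H for idfun}),
     induces_norm dot ->
     forall (N : nat) (v : nat -> H), (0 < N)%N ->
       0 <= \sum_(1 <= n < N.+1)
              dot (\sum_(0 <= j < n) q_coef sigma tau g j *: v (n - j)%N) (v n))
  /\
  (forall (H : completeNormedModType R[i]) (dot : {dot H for Num.conj}),
     induces_norm dot ->
     forall (N : nat) (v : nat -> H), (0 < N)%N ->
       0 <= complex.Re (\sum_(1 <= n < N.+1)
              dot (\sum_(0 <= j < n) (q_coef sigma tau g j)%:C *: v (n - j)%N)
                  (v n))).
Proof.
have q_ge0 := q_toeplitz_ge0 alpha_gt0 alpha_lt1 sigma_ge0 tau_gt0 g_def.
split=> H dot _ N v _; rewrite big_add1/= big_mkord.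
  under eq_bigr => n _.
    rewrite linear_sumlz/= big_mkord.
    under eq_bigr => j _ do rewrite linearZl_LR/= subSn// -1?ltnS//.
    over.
  (* The theorem numbers the vectors from 1, the Gram matrix from 0. *)
  apply: (q_ge0 (fun i j => dot (v i.+1) (v j.+1))) => [i j|n x].
    by rewrite (@hermitian_subproof _ _ _ _ dot) expr0 mul1r.
  suff -> : \sum_(i < n) \sum_(j < n) x i * x j * dot (v i.+1) (v j.+1)
      = dot (\sum_(i < n) x i *: v i.+1) (\sum_(i < n) x i *: v i.+1).
    exact: dot_self_ge0.
  rewrite linear_sumlz; apply: eq_bigr => i _; rewrite linear_sumr/=.
  apply: eq_bigr => j _.
  by rewrite /= [dot (_ *: _) _]linearZl_LR /= [dot _ (_ *: _)]linearZr_LR/= mulrA.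
rewrite (raddf_sum (@complex.Re R : Rcomplex R -> R)).
have ReC u w : complex.Re (dot u w) = complex.Re (dot w u).
  by rewrite (@hermitian_subproof _ _ _ _ dot u w) expr0 mul1r Re_conj.
under eq_bigr => n _.
  rewrite linear_sumlz/= (raddf_sum (@complex.Re R : Rcomplex R -> R)) big_mkord.
  under eq_bigr => j _ do rewrite linearZl_LR/= ReM_real subSn// -1?ltnS//.
  over.
(* The coefficients q are real, so only the real part of the Gram matrix enters; it is symmetric,
   and nonnegative on real vectors. *)
apply: (q_ge0 (fun i j => complex.Re (dot (v i.+1) (v j.+1)))) => [i j|n x].
  exact: ReC.
suff -> : \sum_(i < n) \sum_(j < n) x i * x j * complex.Re (dot (v i.+1) (v j.+1))
    = complex.Re (dot (\sum_(i < n) (x i)%:C *: v i.+1)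
                      (\sum_(i < n) (x i)%:C *: v i.+1)).
  have := dot_self_ge0 dot (\sum_(i < n) (x i)%:C *: v i.+1).
  by rewrite lecE => /andP[].
rewrite linear_sumlz (raddf_sum (@complex.Re R : Rcomplex R -> R)).
apply: eq_bigr => i _.
rewrite linear_sumr/= (raddf_sum (@complex.Re R : Rcomplex R -> R)).
apply: eq_bigr => j _.
rewrite /= [dot (_ *: _) _]linearZl_LR /= [dot _ (_ *: _)]linearZr_LR/=.
by rewrite ReM_real; case: (dot _ _) => a b /=; ring.
Qed.
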